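(* Let $k$ be a real number with $0\leq k\leq 4/3$ and let $S$ be a signature $(k,M)$-matrix, where $M\geq 2$ is an integer. Then there exists a $d\times 2d$ equiangular tight frame for $d=3M$.
   Context: A $d\times n$ equiangular tight frame (ETF) is a collection of $n$ unit vectors $x_1,\dots,x_n$ in $\mathbb{C}^d$ attaining the Welch bound, i.e. $\max_{i\neq j}|\langle x_i,x_j\rangle|^2=\frac{n-d}{d(n-1)}$. A signature $(c,n)$-matrix is an $n\times n$ complex matrix $S$ such that $S=S^*$, all diagonal entries of $S$ are $0$, all off-diagonal entries have absolute value $1$, and $S^2=cS+(n-1)I_n$, where $c=(n-2e)\sqrt{\frac{n-1}{e(n-e)}}$ for some integer $e$ with $1\leq e<n$. (These are exactly the signature matrices of ETFs of $n$ vectors in $\mathbb{C}^e$: the Gram matrix $G$ of such an ETF is $G=I+\alpha S$ with $\alpha=\sqrt{\frac{n-e}{e(n-1)}}$.) *)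

(* Defs.v *)
(* MathComp: C is R[i] for R : realType. *)
From HB Require Import structures.
From mathcomp Require Import all_boot all_order all_algebra.
From mathcomp Require Import complex reals.

Set Implicit Arguments.
Unset Strict Implicit.
Unset Printing Implicit Defensive.

Import Order.TTheory GRing.Theory Num.Theory.

Local Open Scope ring_scope.
Local Open Scope complex_scope.
Local Open Scope sesquilinear_scope.

(* The modulus is [Normc.normc], which takes its values in R, unlike `|_|,
   which takes them in R[i], where the order is only partial.  The default
   value 0 is harmless because all terms are nonnegative; it matters only
   when n <= 1, where there are no terms. *)
Definition max_sq_inner (R : realType) (d n : nat)
    (x : 'I_n -> 'rV[R[i]]_d) : R :=
  \big[Num.max/0]_(p : 'I_n * 'I_n | p.1 != p.2)
     Normc.normc (dotmx (x p.1) (x p.2)) ^+ 2.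

Definition is_etf (R : realType) (d n : nat)
    (x : 'I_n -> 'rV[R[i]]_d) : Prop :=
  (forall i, dotmx (x i) (x i) = 1) /\
  max_sq_inner x = (n%:R - d%:R) / (d%:R * (n%:R - 1)).

Definition signature_param (R : realType) (n e : nat) : R :=
  (n%:R - 2 * e%:R) * Num.sqrt ((n%:R - 1) / (e%:R * (n%:R - e%:R))).

Definition is_signature (R : realType) (c : R) (n : nat)
    (S : 'M[R[i]]_n) : Prop :=
  [/\ S = S ^t*,
      forall i, S i i = 0,
      forall i j, i != j -> `|S i j| = 1,
      S *m S = c%:C *: S + (n%:R - 1)%:M
    & exists e : nat, (1 <= e < n)%N /\ c = signature_param R n e].

(* Main.v *)
(* A signature (0, n)-matrix T with n = 2d has T^2 = (n-1) I, so
   (I + T / sqrt (n-1)) / 2 is an orthogonal projection of rank tr = d;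
   factoring it as X* X with orthonormal rows X, the columns of X scaled by
   sqrt 2 form a d x 2d ETF.  For n = 6M take T = A (x) S + B (x) I, where A is
   a Hermitian complex Hadamard matrix of order 6 (A^2 = 6 I) and B a Hermitian
   conference matrix of order 6 (B^2 = 5 I).  Since S^2 = k S + (M-1) I, the
   terms linear in S cancel in T^2 as soon as A B + B A = -6k I.  For the fixed
   A below, such B form a one-parameter family with two unimodular entries z
   and w subject to Re z = 3k/4 and Re w - Im w = 1 - 3k/2, which can
   be met whenever 0 <= k <= 4/3. *)
Require Import Defs.
From mathcomp Require Import all_boot all_order all_algebra.
From mathcomp Require Import complex reals mxtens.
From mathcomp Require Import ring lra.

Set Implicit Arguments.
Unset Strict Implicit.
Unset Printing Implicit Defensive.

Import Order.TTheory GRing.Theory Num.Theory.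
Local Open Scope ring_scope.
Local Open Scope complex_scope.
Local Open Scope sesquilinear_scope.

(** In a full-rank factorization [P = K *m L], cancelling [K] on the left and [L] on the right of
    [P *m P = P] leaves [L *m K = 1], whose trace is the rank. *)
Lemma mxtrace_idempotent (F : fieldType) (n : nat) (P : 'M[F]_n) :
  P *m P = P -> \tr P = (\rank P)%:R.
Proof.
move=> PP.
have CR : row_base P *m col_base P = 1%:M.
  apply: (row_full_inj (col_base_full P)); apply: (row_free_inj (row_base_free P)).
  by rewrite mulmx1 mulmxA mulmx_base -[LHS]mulmxA mulmx_base PP.
by rewrite -{1}(mulmx_base P) mxtrace_mulC CR mxtrace1.
Qed.

Lemma trmxC_mul (C : numClosedFieldType) (m n p : nat)
    (A : 'M[C]_(m, n)) (B : 'M[C]_(n, p)) :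
  (A *m B)^t* = B^t* *m A^t*.
Proof. by rewrite trmx_mul map_mxM. Qed.

(** Gram-Schmidt on the row space of [P] gives [X]. Then [X *m P = X], so [P *m X^t* = X^t*] by
    taking adjoints; writing [P = Y *m X] and multiplying by [X^t*] forces [Y = X^t*]. *)
Lemma orthogonal_projection_factor (C : numClosedFieldType) (d n : nat)
    (P : 'M[C]_n) :
  P^t* = P -> P *m P = P -> \tr P = d%:R ->
  exists2 X : 'M[C]_(d, n), X *m X^t* = 1%:M & P = X^t* *m X.
Proof.
move=> Ph PP trP.
have rkP : \rank P = d.
  by apply/eqP; rewrite -(@eqr_nat C) -mxtrace_idempotent // trP.
suff [X XX XP] : exists2 X : 'M[C]_(\rank P, n), X *m X^t* = 1%:M & (X :=: P)%MS.
  move: X XX XP; rewrite rkP => X XX XP; exists X => //.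
  have /submxP[Y PYX] : (P <= X)%MS by rewrite XP.
  have /submxP[Z XZP] : (X <= P)%MS by rewrite XP.
  have XPX : X *m P = X by rewrite XZP -mulmxA PP.
  have PX : P *m X^t* = X^t* by rewrite -{1}Ph -trmxC_mul XPX.
  suff -> : X^t* = Y by [].
  by rewrite -PX {1}PYX -mulmxA XX mulmx1.
exists (schmidt (row_base P)).
  by apply/unitarymxP/schmidt_unitarymx/rank_leq_col.
apply: eqmx_trans (eq_row_base P).
by apply: eqmx_schmidt_free; apply: row_base_free.
Qed.

Definition is_conference (C : numClosedFieldType) (n : nat) (T : 'M[C]_n) :=
  [/\ T^t* = T, forall i, T i i = 0, forall i j, i != j -> `|T i j| = 1
    & T *m T = (n%:R - 1)%:M].

Lemma etf_of_conference (R : realType) (d n : nat) (T : 'M[R[i]]_n) :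
  n = (2 * d)%N -> (0 < d)%N -> is_conference T ->
  exists x : 'I_n -> 'rV[R[i]]_d, is_etf x.
Proof.
move=> nd d0 [Th T0 T1 TT].
have n1 : (1 < n)%N by rewrite nd; case: d d0 {nd} => // d' _; rewrite mulnS.
pose s : R := n%:R - 1.
have s0 : 0 < s by rewrite subr_gt0 ltr1n.
have sC : n%:R - 1 = s%:C :> R[i] by rewrite rmorphB rmorph_nat rmorph1.
pose a : R[i] := (Num.sqrt s)^-1%:C.
have realC (r : R) : (r%:C)^* = r%:C :> R[i].
  by rewrite /Num.conj /= oppr0.
have aC : a^* = a by exact: realC.
have aa : a * a * (n%:R - 1) = 1.
  rewrite sC -!rmorphM -invfM -expr2 sqr_sqrtr ?ltW // mulVf ?rmorph1 //.
  by rewrite gt_eqF.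
pose P : 'M[R[i]]_n := 2^-1 *: (1%:M + a *: T).
have [] := @orthogonal_projection_factor _ d _ P.
- rewrite /P linearZ /= map_mxZ linearD /= map_mxD linearZ /= map_mxZ.
  rewrite trmx1 map_mx1 Th; congr (_ *: (_ + _ *: _)); last exact: aC.
  by rewrite fmorphV rmorph_nat.
- have : (a *: T) *m (a *: T) = 1%:M.
    by rewrite -scalemxAl -scalemxAr TT !scalerA -scalemx1 scalerA aa scale1r.
  rewrite /P; move: (a *: T) => E EE.
  rewrite -scalemxAl -scalemxAr mulmxDl !mulmxDr !mul1mx !mulmx1 EE.
  rewrite [E + _]addrC -mulr2n -[(1%:M + E) *+ 2]scaler_nat !scalerA.
  rewrite -mulrA mulVf ?mulr1 //.
  by rewrite pnatr_eq0.
- rewrite /P mxtraceZ mxtraceD mxtraceZ mxtrace1.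
  rewrite [\tr T]big1 // mulr0 addr0 nd natrM mulrA mulVf ?mul1r //.
  by rewrite pnatr_eq0.
move=> X XX PX.
pose b : R[i] := (Num.sqrt 2)%:C.
(* As rows, the frame vectors are the conjugated columns of [X]; their Gram matrix is [2 *: P], that
   is, [1 + a *: T]. *)
have dotE i j : dotmx (b *: row i (X^t*)) (b *: row j (X^t*)) = (i == j)%:R + a * T i j.
  have -> : (i == j)%:R + a * T i j = 2 * P i j.
    by rewrite !mxE mulrA divff ?mul1r // pnatr_eq0.
  rewrite dotmxE linearZ /= map_mxZ -scalemxAl -scalemxAr scalerA mxE; congr (_ * _).
    rewrite [X in _ * X](realC _) -rmorphM -expr2 sqr_sqrtr ?ler0n //.
    by rewrite rmorph_nat.
  by rewrite PX !mxE; apply: eq_bigr => l _; rewrite !mxE; congr (_ * _); exact: conjCK.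
exists (fun i => b *: row i (X^t*)); split=> [i|].
  by rewrite dotE eqxx T0 mulr0 addr0.
have dotN i j : i != j -> Normc.normc (dotmx (b *: row i (X^t*)) (b *: row j (X^t*))) ^+ 2 = s^-1.
  move=> ij; rewrite dotE (negPf ij) add0r.
  have normcC (z : R[i]) : `|z| = (Normc.normc z)%:C by [].
  have normT : Normc.normc (T i j) = 1.
    by apply: complexI; rewrite -normcC T1.
  have normca : Normc.normc a = (Num.sqrt s)^-1.
    by rewrite /Normc.normc /= expr0n addr0 sqrtr_sqr ger0_norm ?invr_ge0 ?sqrtr_ge0.
  by rewrite Normc.normcM normT mulr1 normca exprVn sqr_sqrtr ?ltW.
have -> : max_sq_inner (fun i => b *: row i (X^t*)) = s^-1.
  apply/le_anti/andP; split.
    by apply: bigmax_le => [|p pP]; [rewrite invr_ge0 ltW | rewrite dotN].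
  (* The pair (0, 1) shows that the maximum runs over a nonempty set, so it is not the default 0. *)
  pose p0 := (Ordinal (ltnW n1), Ordinal n1).
  by apply: (@bigmax_sup _ _ _ _ p0) => //; rewrite dotN.
have -> : n%:R - d%:R = d%:R :> R by rewrite nd natrM; ring.
by rewrite invfM mulrA divff ?mul1r // pnatr_eq0 -lt0n.
Qed.

(** The zero diagonal of [S] keeps the two summands from overlapping, so each entry comes from one
    of them. In the square the scalar part is m(M - 1) + (m - 1) = mM - 1. *)
Lemma conference_tens (C : numClosedFieldType) (m M : nat) (k : C)
    (A B : 'M[C]_m) (S : 'M[C]_M) :
  A^t* = A -> (forall i j, `|A i j| = 1) -> A *m A = m%:R%:M ->
  is_conference B -> A *m B + B *m A = (- (m%:R * k))%:M ->
  S^t* = S -> (forall i, S i i = 0) -> (forall i j, i != j -> `|S i j| = 1) ->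
  S *m S = k *: S + (M%:R - 1)%:M ->
  is_conference (A *t S + B *t (1%:M : 'M_M)).
Proof.
move=> Ah A1 AA [Bh B0 B1 BB] AB Sh S0 S1 SS; split.
- by rewrite linearD /= !trmx_tens map_mxD !map_mxT Ah Bh Sh trmx1 map_mx1.
- move=> i; case: (mxtens_indexP i) => i0 i1.
  by rewrite !mxE mxtens_indexK /= S0 B0 mul0r mulr0 addr0.
- move=> i j; case: (mxtens_indexP i) => i0 i1; case: (mxtens_indexP j) => j0 j1 ij.
  rewrite !mxE !mxtens_indexK /=; have [e|ne] := eqVneq i1 j1.
    rewrite e S0 mulr0 add0r mulr1 B1 //.
    by apply: contraNneq ij => ->; rewrite e.
  by rewrite mulr0 addr0 normrM A1 S1 ?mulr1.
- rewrite mulmxDl !mulmxDr !tensmx_mul !mulmx1 !mul1mx AA BB SS.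
  apply/matrixP => i j.
  case: (mxtens_indexP i) => i0 i1; case: (mxtens_indexP j) => j0 j1.
  (* Eliminating [B *m A] leaves one unknown entry, which then cancels under [ring]. *)
  have ABE : (B *m A) i0 j0 = - (m%:R * k) *+ (i0 == j0) - (A *m B) i0 j0.
    have /matrixP /(_ i0 j0) := AB.
    rewrite [LHS]mxE [RHS]mxE => <-. by rewrite addrAC subrr add0r.
  have ijE : (mxtens_index (i0, i1) == mxtens_index (j0, j1)) = (i0 == j0) && (i1 == j1).
    by rewrite (can_eq (@mxtens_indexK _ _)).
  rewrite [LHS]mxE [X in X + _]mxE [X in _ + X]mxE !tensmxE ABE.
  set ab := (A *m B) i0 j0; rewrite !mxE ijE natrM.
  case: eqP; case: eqP => _ _ /=; rewrite ?mulr1n ?mulr0n; ring.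
Qed.

Definition mx6 (C : nzRingType) (s : seq (seq C)) : 'M[C]_6 :=
  \matrix_(i, j) nth 0 (nth [::] s i) j.

Definition hadamard6 (R : realType) : 'M[R[i]]_6 :=
  let q := 'i : R[i] in
  mx6 [:: [:: 1; -1; -1; q; 1; 1];
          [:: -1; 1; -1; 1; q; 1];
          [:: -1; -1; 1; 1; 1; q];
          [:: - q; 1; 1; -1; 1; 1];
          [:: 1; - q; 1; 1; -1; 1];
          [:: 1; 1; - q; 1; 1; -1]].

Definition conference6 (R : realType) (z w : R[i]) : 'M[R[i]]_6 :=
  let z' := z^*%C in let w' := w^*%C in
  mx6 [:: [:: 0; z; z; 1; - z; - z];
          [:: z'; 0; 1; - z'; - w; w];
          [:: z'; 1; 0; - z'; w; - w];
          [:: 1; - z; - z; 0; - z; - z];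
          [:: - z'; - w'; w'; - z'; 0; -1];
          [:: - z'; w'; - w'; - z'; -1; 0]].

Ltac entrywise6 :=
  let i := fresh "i" in let j := fresh "j" in
  move=> i j; rewrite ?mxE ?big_ord_recl ?big_ord0 ?mxE;
  case: i => [[|[|[|[|[|[|//]]]]]] ?]; case: j => [[|[|[|[|[|[|//]]]]]] ?] //=.

(** Real and imaginary parts are compared separately; [lra] treats monomials such as [c ^+ 2] as
    atoms, in which the hypotheses are linear. *)
Ltac complex_lra := 
  apply/eqP; rewrite eq_complex /=; apply/andP; split; apply/eqP; lra.

Lemma hadamard6_herm (R : realType) : (hadamard6 R)^t* = hadamard6 R.
Proof.
apply/matrixP; entrywise6.
all: complex_lra.
Qed.

Lemma hadamard6_norm (R : realType) i j : `|hadamard6 R i j| = 1.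
Proof.
have ni : `|'i%C : R[i]| = 1.
  by rewrite normc_def /= expr0n expr1n add0r sqrtr1.
by move: i j; entrywise6; rewrite ?normrN ?normr1 ?ni.
Qed.

Lemma hadamard6_sqr (R : realType) : hadamard6 R *m hadamard6 R = 6%:R%:M.
Proof.
apply/matrixP; entrywise6.
all: complex_lra.
Qed.

Lemma conference6P (R : realType) (c s a b : R) :
  c ^+ 2 + s ^+ 2 = 1 -> a ^+ 2 + b ^+ 2 = 1 ->
  is_conference (conference6 (c +i* s) (a +i* b)).
Proof.
move=> zz ww; split.
- by apply/matrixP; entrywise6; complex_lra.
- by case=> [[|[|[|[|[|[|//]]]]]] ?]; rewrite mxE.
- have nz x y : x ^+ 2 + y ^+ 2 = 1 -> `|x +i* y : R[i]| = 1.
    by move=> xy; rewrite normc_def /= xy sqrtr1.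
  entrywise6; rewrite ?normrN ?normr1 ?nz ?sqrrN //.
- apply/matrixP; entrywise6.
  all: complex_lra.
Qed.

(** The diagonal entry at index 0 is -8c, and the one at index 1 is 2(a - b - 1 - 2c); equating them
    gives the hypothesis. *)
Lemma anticomm6 (R : realType) (c s a b : R) :
  a - b = 1 - 2 * c ->
  hadamard6 R *m conference6 (c +i* s) (a +i* b) +
  conference6 (c +i* s) (a +i* b) *m hadamard6 R = (- (6%:R * (4 / 3 * c)%:C))%:M.
Proof.
move=> ab; apply/matrixP; entrywise6.
all: complex_lra.
Qed.

Theorem corollary4 (R : realType) (k : R) (hk : 0 <= k <= 4 / 3)
    (M : nat) (hM : (2 <= M)%N) (S : 'M[R[i]]_M) (hS : is_signature k S) :
  exists x : 'I_(2 * (3 * M)) -> 'rV[R[i]]_(3 * M), is_etf x.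
Proof.
case: hS => Sh S0 S1 SS _; case/andP: hk => k0 k43.
(* This makes 8c = 6k. The bounds on [k] put [c] in [0, 1] and [t] in [-1, 1], so both radicands
   below are nonnegative. *)
pose c := 3 / 4 * k; pose t := 1 - 2 * c.
pose s := Num.sqrt (1 - c ^+ 2); pose r := Num.sqrt (2 - t ^+ 2).
have ss : s ^+ 2 = 1 - c ^+ 2 by rewrite sqr_sqrtr //; rewrite /c; nra.
have rr : r ^+ 2 = 2 - t ^+ 2 by rewrite sqr_sqrtr //; rewrite /t /c; nra.
(* These solve a - b = t and a + b = r; [r] was chosen so that t^2 + r^2 = 2, which puts (a, b) on
   the unit circle. *)
pose a := (t + r) / 2; pose b := (r - t) / 2.
have zz : c ^+ 2 + s ^+ 2 = 1 by rewrite ss; ring.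
have ww : a ^+ 2 + b ^+ 2 = 1.
  have -> : a ^+ 2 + b ^+ 2 = (t ^+ 2 + r ^+ 2) / 2 by rewrite /a /b; field.
  by rewrite rr addrC subrK divff ?pnatr_eq0.
have ab : a - b = 1 - 2 * c by rewrite /a /b -/t; field.
have kE : 4 / 3 * c = k by rewrite /c; field.
have n6 : (2 * (3 * M) = 6 * M)%N by rewrite mulnA.
rewrite n6; apply: etf_of_conference (esym n6) _ _.
  by rewrite muln_gt0 /= ltnW.
apply: (conference_tens (hadamard6_herm R) (@hadamard6_norm R)
  (hadamard6_sqr R) (conference6P zz ww) _ (esym Sh) S0 S1 SS).
by rewrite (anticomm6 s ab) kE.
Qed.
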